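(* Let $\mathcal{X}\subseteq\mathbb{R}^d$ be nonempty, closed and convex, let $f:\mathbb{R}^d\to\mathbb{R}$ be differentiable, $L$-smooth and $\mu$-strongly convex on $\mathcal{X}$ ($0<\mu\le L$), and assume $\mathcal{X}_\star:=\operatorname{arg\,min}_{x\in\mathcal{X}} f(x)$ is nonempty. Let $\{x_k\}_{k\ge0}$ be generated by the Local LMO iteration $x_{k+1}\in\operatorname{arg\,min}_{z\in\mathcal{X}\cap\mathcal{B}(x_k,t_k)}\langle\nabla f(x_k),z\rangle$ with $x_0\in\mathcal{X}$, and let $x_\star\in\mathcal{X}_\star$. Set $\theta=\frac{2\sqrt{\mu L}}{L+\mu}$. Fix $k\ge0$; if $\nabla f(x_k)\ne\nabla f(x_\star)$ and $t_k=\theta\|x_k-x_\star\|$, then $$\|x_{k+1}-x_\star\|^2\le(1-\theta^2)\|x_k-x_\star\|^2=\Big(\frac{L-\mu}{L+\mu}\Big)^2\|x_k-x_\star\|^2.$$ Hence, with the radii $t_k=\theta\|x_k-x_\star\|$ used at every iteration, for any $K\ge0$, $$\|x_K-x_\star\|^2\le\Big(\frac{L-\mu}{L+\mu}\Big)^{2K}\|x_0-x_\star\|^2.$$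
   Context: $\|\cdot\|$ is the Euclidean norm, $\mathcal{B}(x,t):=\{y:\|y-x\|\le t\}$. $L$-smooth: $\nabla f$ is $L$-Lipschitz. $\mu$-strongly convex: $f(y)\ge f(x)+\langle\nabla f(x),y-x\rangle+\frac{\mu}{2}\|y-x\|^2$. *)

(* Defs.v *)
From HB Require Import structures.
From mathcomp Require Import all_boot all_order all_algebra.
From mathcomp Require Import all_classical all_reals all_analysis.
Set Implicit Arguments. Unset Strict Implicit. Unset Printing Implicit Defensive.
Import Order.TTheory GRing.Theory Num.Theory.
Import numFieldNormedType.Exports.
Local Open Scope ring_scope.
Local Open Scope classical_set_scope.

Section Defs.
Variables (R : realType) (d : nat).

Definition dotv (u v : 'rV[R]_d) : R := \sum_(i < d) u ord0 i * v ord0 i.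
Definition enorm (u : 'rV[R]_d) : R := Num.sqrt (dotv u u).

Definition eball (x : 'rV[R]_d) (t : R) : set 'rV[R]_d :=
  [set y | enorm (y - x) <= t].

Definition is_gradient (f : 'rV[R]_d -> R) (g : 'rV[R]_d -> 'rV[R]_d) : Prop :=
  forall x, differentiable f x /\ forall h, 'd f x h = dotv (g x) h.

Definition smooth_on (X : set 'rV[R]_d) (g : 'rV[R]_d -> 'rV[R]_d) (L : R) :=
  forall x y, X x -> X y -> enorm (g x - g y) <= L * enorm (x - y).

Definition strongly_convex_on (X : set 'rV[R]_d) (f : 'rV[R]_d -> R)
  (g : 'rV[R]_d -> 'rV[R]_d) (mu : R) :=
  forall x y, X x -> X y ->
    f x + dotv (g x) (y - x) + mu / 2 * enorm (y - x) ^+ 2 <= f y.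

Definition is_argmin (A : set 'rV[R]_d) (phi : 'rV[R]_d -> R) (z : 'rV[R]_d) :=
  A z /\ forall y, A y -> phi z <= phi y.

Definition local_LMO (X : set 'rV[R]_d) (g : 'rV[R]_d -> 'rV[R]_d)
  (t : nat -> R) (x : nat -> 'rV[R]_d) : Prop :=
  X (x 0%N) /\
  forall k, is_argmin (X `&` eball (x k) (t k)) (dotv (g (x k))) (x k.+1).

End Defs.

Definition theta (R : realType) (L mu : R) : R :=
  2 * Num.sqrt (mu * L) / (L + mu).

(* Main.v *)
(** Write [u = x_k - x_*], [p = x_{k+1} - x_*], [D = g x_k - g x_*] and
    [kappa = (L - mu) / (L + mu)], so that [theta^2 = 1 - kappa^2].  The heart
    of the proof is the secant inequality
      [(L + mu) <p, u> - (L - mu) |u| |p| <= 2 <D, p>].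
    Since [f] is smooth and strongly convex on [X] only, cocoercivity of the
    gradient is not available.  Instead, for [y], [y + e] and the two points
    [y + e/2 +- q] in [X], two strong convexity and two descent inequalities
    give [2 <g (y + e) - g y, q> >= mu |q + e/2|^2 - L |q - e/2|^2]; summing this
    over a fine partition of the segment from [x_*] to [x_k], with [q] a small
    multiple of [p], yields the claim.
    If [|p| > kappa |u|], then [|p - u| <= theta |u|] makes the left-hand side
    positive, hence [<g x_k, p> > 0] by optimality of [x_*].  Moving from
    [x_{k+1}] towards [x_*] by the fraction [1 - kappa^2 |u|^2 / |p|^2] then
    stays in the ball and decreases the linear functional, contradicting the
    choice of [x_{k+1}]. *)
Require Import Defs.
From HB Require Import structures.
From mathcomp Require Import all_boot all_order all_algebra.
From mathcomp Require Import all_classical all_reals all_analysis.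
From mathcomp Require Import ring lra.
Import Order.TTheory GRing.Theory Num.Theory.
Import numFieldNormedType.Exports.
Local Open Scope ring_scope.
Local Open Scope classical_set_scope.

(** * Euclidean inner product and norm, and a limit argument *)

Section EuclideanSpace.
Context {R : realType} {d : nat}.
Implicit Types (a s : R) (u v w : 'rV[R]_d).

Lemma dotvC u v : dotv u v = dotv v u.
Proof. by apply: eq_bigr => i _; rewrite mulrC. Qed.

Lemma dotvDl u v w : dotv (u + v) w = dotv u w + dotv v w.
Proof. by rewrite -big_split; apply: eq_bigr => i _; rewrite mxE mulrDl. Qed.

Lemma dotvZl a u v : dotv (a *: u) v = a * dotv u v.
Proof. by rewrite mulr_sumr; apply: eq_bigr => i _; rewrite mxE mulrA. Qed.

Lemma dotvNl u v : dotv (- u) v = - dotv u v.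
Proof. by rewrite -scaleN1r dotvZl mulN1r. Qed.

Lemma dotvDr u v w : dotv w (u + v) = dotv w u + dotv w v.
Proof. by rewrite dotvC dotvDl !(dotvC w). Qed.

Lemma dotvZr a u v : dotv v (a *: u) = a * dotv v u.
Proof. by rewrite dotvC dotvZl (dotvC v). Qed.

Lemma dotvNr u v : dotv v (- u) = - dotv v u.
Proof. by rewrite dotvC dotvNl (dotvC v). Qed.

Definition dotvE := (dotvDl, dotvDr, dotvNl, dotvNr, dotvZl, dotvZr).

Lemma dotvv_ge0 u : 0 <= dotv u u.
Proof. by apply: sumr_ge0 => i _; rewrite -expr2 sqr_ge0. Qed.

Lemma enorm_ge0 u : 0 <= enorm u.
Proof. exact: sqrtr_ge0. Qed.

Lemma enorm_sqr u : enorm u ^+ 2 = dotv u u.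
Proof. by rewrite sqr_sqrtr // dotvv_ge0. Qed.

Lemma enorm_le u a : 0 <= a -> (enorm u <= a) = (dotv u u <= a ^+ 2).
Proof. by move=> a0; rewrite -enorm_sqr ler_sqr // nnegrE enorm_ge0. Qed.

Lemma enorm0_eq0 u : enorm u = 0 -> u = 0.
Proof.
move=> u0; have /eqP : dotv u u = 0 by rewrite -enorm_sqr u0 expr0n.
rewrite psumr_eq0 => [/allP h|i _]; last by rewrite -expr2 sqr_ge0.
apply/rowP => i; have := h i; rewrite mem_index_enum => /(_ isT).
by rewrite mulf_eq0 orbb mxE => /eqP.
Qed.

Lemma enormN u : enorm (- u) = enorm u.
Proof. by rewrite /enorm !dotvE opprK. Qed.

Lemma enormZ a u : 0 <= a -> enorm (a *: u) = a * enorm u.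
Proof.
move=> a0; rewrite /enorm !dotvE mulrA -expr2 sqrtrM ?sqr_ge0 //.
by rewrite sqrtr_sqr ger0_norm.
Qed.

Lemma cauchy_schwarz u v : dotv u v <= enorm u * enorm v.
Proof.
have := enorm_ge0 u; rewrite le_eqVlt => /predU1P[/esym u0|u0].
  by rewrite u0 mul0r (enorm0_eq0 _ u0) -(scale0r u) dotvZl mul0r.
have := enorm_ge0 v; rewrite le_eqVlt => /predU1P[/esym v0|v0].
  by rewrite v0 mulr0 (enorm0_eq0 _ v0) -(scale0r v) dotvZr mul0r.
(* This square expands to [2 |u| |v| (|u| |v| - <u, v>)]. *)
have := dotvv_ge0 (enorm v *: u - enorm u *: v).
rewrite !dotvE (dotvC v u) -!enorm_sqr => h.
have uv0 : 0 < enorm u * enorm v by rewrite mulr_gt0.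
rewrite -(ler_pM2l uv0); nra.
Qed.

(** Stands in for letting [e] tend to 0: a gap [D = A - B > 0] fails at [e = D / (2 (D + |C|))],
    where [e * C <= D / 2]. *)
Lemma ler_lim0 (A B C : R) :
  (forall e : R, 0 < e -> e < 1 -> A <= B + e * C) -> A <= B.
Proof.
move=> h; rewrite leNgt; apply/negP => BA.
set D := A - B; have D0 : 0 < D by rewrite subr_gt0.
have C0 := normr_ge0 C; have CC := ler_norm C.
have E0 : 0 < 2 * (D + `|C|) by lra.
set e := D / (2 * (D + `|C|)).
have e0 : 0 < e by rewrite divr_gt0.
have eE : e * (2 * (D + `|C|)) = D by rewrite /e divfK // gt_eqF.
have e1 : e < 1 by rewrite ltr_pdivrMr //; lra.
by have := h e e0 e1; rewrite /D in eE D0 *; nra.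
Qed.

End EuclideanSpace.

Lemma theta_sqr (R : realType) (L mu : R) : 0 < mu -> mu <= L ->
  theta L mu ^+ 2 = 1 - ((L - mu) / (L + mu)) ^+ 2.
Proof.
move=> mu0 muL; rewrite /theta !exprMn sqr_sqrtr ?mulr_ge0 ?ltW //; last by lra.
by field; rewrite gt_eqF //; lra.
Qed.

(** * Descent and optimality on the convex set [X] *)

Section SmoothStronglyConvex.
Context {R : realType} {d : nat}.
Variables (X : set 'rV[R]_d) (f : 'rV[R]_d -> R) (g : 'rV[R]_d -> 'rV[R]_d).
Variables (L mu : R).
Hypotheses (cX : convex_set X) (mu0 : 0 < mu) (muL : mu <= L).
Hypotheses (smo : smooth_on X g L) (sc : strongly_convex_on X f g mu).

Lemma convex_segment a b s : X a -> X b -> 0 <= s -> s <= 1 ->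
  X (a + s *: (b - a)).
Proof.
move=> Xa Xb s0 s1.
have -> : a + s *: (b - a) = s *: b + (1 - s) *: a.
  by apply/rowP => i; rewrite !mxE; ring.
exact: set_mem (cX b a (Itv01 s0 s1) (mem_set Xb) (mem_set Xa)).
Qed.

Lemma convex_triangle o u p a b : X o -> X (o + u) -> X (o + p) ->
  0 <= a -> 0 <= b -> a + b <= 1 -> X (o + a *: u + b *: p).
Proof.
move=> Xo Xu Xp a0 b0 ab1.
have [ab0|abN0] := eqVneq (a + b) 0.
  have [-> ->] : a = 0 /\ b = 0 by lra.
  by rewrite !scale0r !addr0.
have ab0 : 0 < a + b by rewrite lt_neqAle eq_sym abN0; lra.
have b1 : b / (a + b) <= 1 by rewrite ler_pdivrMr //; lra.
have := convex_segment _ _ _ Xu Xp (divr_ge0 b0 (ltW ab0)) b1.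
move=> /(convex_segment _ _ (a + b) Xo) /(_ (ltW ab0) ab1).
by congr X; apply/rowP => i; rewrite !mxE; field.
Qed.

Lemma smooth_dotv x y w : X x -> X y ->
  dotv (g x - g y) w <= L * enorm (x - y) * enorm w.
Proof.
move=> Xx Xy; apply: le_trans (cauchy_schwarz _ _) _.
by rewrite ler_wpM2r ?enorm_ge0 // smo.
Qed.

Lemma convex_above x y : X x -> X y -> f y - f x <= dotv (g y) (y - x).
Proof.
move=> Xx Xy; have := sc _ _ Xy Xx.
have : 0 <= mu / 2 * enorm (x - y) ^+ 2.
  by rewrite mulr_ge0 ?sqr_ge0 // divr_ge0 // ltW.
rewrite -[x - y]opprB dotvNr; lra.
Qed.

(* Riemann sums of the monotone gradient replace the integral of [g] along the
   segment. *)
Lemma descent b z : X b -> X z ->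
  f z <= f b + dotv (g b) (z - b) + L / 2 * enorm (z - b) ^+ 2.
Proof.
move=> Xb Xz; set w := z - b; set W := enorm w ^+ 2.
apply: (@ler_lim0 R _ _ (L / 2 * W)) => e e0 e1.
have [n nE] : exists n, e^-1 < n.+1%:R.
  by exists (Num.truncn e^-1); exact: truncnS_gt.
have [N NE] : exists N : R, N = n.+1%:R by exists n.+1%:R.
have N0 : 0 < N by rewrite NE ltr0n.
have Ne : N^-1 <= e by rewrite NE -[e]invrK lef_pV2 ?posrE ?invr_gt0 ?ltr0n // ltW.
have W0 : 0 <= W by rewrite sqr_ge0.
have L0 : 0 < L by exact: lt_le_trans muL.
(* Slopes are taken at right endpoints; the quadratic term is the sum of [L * W * j / N ^+ 2] for
   [j] from 1 to [i], so the excess over [L / 2 * W] at [i = N] is only [L / 2 * W / N]. *)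
have H i : (i <= n.+1)%N -> f (b + (i%:R / N) *: w) <= f b +
    (i%:R / N) * dotv (g b) w + L / 2 * W * (i%:R * (i%:R + 1) / N ^+ 2).
  elim: i => [_|i IH iN].
    by rewrite !mul0r scale0r !mulr0 !addr0.
  have seg j : (j <= n.+1)%N -> X (b + (j%:R / N) *: w).
    move=> jN; apply: convex_segment => //; first by rewrite divr_ge0 // ltW.
    by rewrite ler_pdivrMr // mul1r NE ler_nat.
  have := convex_above _ _ (seg _ (ltnW iN)) (seg _ iN).
  have := smooth_dotv _ _ w (seg _ iN) Xb.
  have -> : b + (i.+1%:R / N) *: w - b = (i.+1%:R / N) *: w.
    by rewrite addrC addKr.
  have -> : b + (i.+1%:R / N) *: w - (b + (i%:R / N) *: w) = N^-1 *: w.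
    by apply/rowP => j; rewrite !mxE -natr1; field; rewrite gt_eqF.
  rewrite enormZ ?divr_ge0 ?(ltW N0) // dotvDl dotvNl dotvZr -(natr1 i).
  have -> : L * ((i%:R + 1) / N * enorm w) * enorm w = L * ((i%:R + 1) / N * W).
    by rewrite /W; ring.
  move=> h1 h2; have := IH (ltnW iN).
  have : N^-1 * (dotv (g (b + ((i%:R + 1) / N) *: w)) w)
      <= N^-1 * (dotv (g b) w + L * ((i%:R + 1) / N * W)).
    by rewrite ler_pM2l ?invr_gt0 // -lerBlDl.
  set F := dotv (g (_ + _)) w in h1 h2 *; move=> h3 h4.
  have -> : (i%:R + 1) / N * dotv (g b) w =
      i%:R / N * dotv (g b) w + N^-1 * dotv (g b) w by ring.
  have -> : L / 2 * W * ((i%:R + 1) * (i%:R + 1 + 1) / N ^+ 2) =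
    L / 2 * W * (i%:R * (i%:R + 1) / N ^+ 2) +
    N^-1 * (L * ((i%:R + 1) / N * W)) by field; rewrite gt_eqF.
  by lra.
have := H n.+1 (leqnn _); rewrite -NE divff ?gt_eqF // scale1r mul1r.
have -> : b + w = z by rewrite /w addrC subrK.
have -> : N * (N + 1) / N ^+ 2 = 1 + N^-1 by field; rewrite gt_eqF.
have : L / 2 * W * N^-1 <= L / 2 * W * e.
  by rewrite ler_wpM2l // mulr_ge0 // divr_ge0 // ltW.
by lra.
Qed.

(** A step of length [e] towards [y] cannot lower [f]; divide the descent bound by [e] and let [e]
    tend to 0. *)
Lemma argmin_dotv_ge0 xs y : is_argmin X f xs -> X y ->
  0 <= dotv (g xs) (y - xs).
Proof.
move=> [Xs ms] Xy.
apply: (@ler_lim0 R _ _ (L / 2 * enorm (y - xs) ^+ 2)) => e e0 e1.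
have Xe := convex_segment _ _ _ Xs Xy (ltW e0) (ltW e1).
have := le_trans (ms _ Xe) (descent _ _ Xs Xe).
have -> : xs + e *: (y - xs) - xs = e *: (y - xs) by rewrite addrC addKr.
rewrite enormZ ?(ltW e0) // dotvZr -(pmulr_rge0 _ e0); lra.
Qed.

(** * The secant inequality *)

Lemma four_points y e q : X y -> X (y + e) ->
  X (y + 2^-1 *: e + q) -> X (y + 2^-1 *: e - q) ->
  0 <= 2 * dotv (g (y + e) - g y) q + (L * enorm (q - 2^-1 *: e) ^+ 2
        - mu * enorm (q + 2^-1 *: e) ^+ 2).
Proof.
move=> Xa Xb Xz Xz'.
(* When the four inequalities are added, all values of [f] cancel, and so do the gradient terms
   along [e]. *)
have := sc _ _ Xa Xz; have := sc _ _ Xb Xz'.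
have := descent _ _ Xb Xz; have := descent _ _ Xa Xz'.
have -> : y + 2^-1 *: e + q - y = q + 2^-1 *: e.
  by apply/rowP => i; rewrite !mxE; field.
have -> : y + 2^-1 *: e - q - y = - (q - 2^-1 *: e).
  by apply/rowP => i; rewrite !mxE; field.
have -> : y + 2^-1 *: e + q - (y + e) = q - 2^-1 *: e.
  by apply/rowP => i; rewrite !mxE; field.
have -> : y + 2^-1 *: e - q - (y + e) = - (q + 2^-1 *: e).
  by apply/rowP => i; rewrite !mxE; field.
rewrite !enormN !dotvNr !dotvDl !dotvNl !dotvDr !dotvNr; lra.
Qed.

(** The gradient differences telescope, while every step contributes the same quadratic term. *)
Lemma four_points_chain y e q N :
  (forall i, (i <= N)%N -> X (y + i%:R *: e)) ->
  (forall i, (i < N)%N -> X (y + (i%:R + 2^-1) *: e + q)) ->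
  (forall i, (i < N)%N -> X (y + (i%:R + 2^-1) *: e - q)) ->
  0 <= 2 * dotv (g (y + N%:R *: e) - g y) q
    + N%:R * (L * enorm (q - 2^-1 *: e) ^+ 2 - mu * enorm (q + 2^-1 *: e) ^+ 2).
Proof.
elim: N => [|N IH] Xy Xp Xm.
  by rewrite scale0r addr0 subrr -(scale0r q) dotvZl !mul0r mulr0 addr0.
have h : forall v, y + N%:R *: e + 2^-1 *: e + v = y + (N%:R + 2^-1) *: e + v.
  by move=> v; rewrite scalerDl addrA.
have := four_points (y + N%:R *: e) e q (Xy N (leqnSn _)).
rewrite !h => /(_ _ (Xp _ (ltnSn _)) (Xm _ (ltnSn _))).
have -> : y + N%:R *: e + e = y + N.+1%:R *: e.
  by rewrite -natr1 scalerDl scale1r addrA.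
move=> /(_ (Xy _ (leqnn _))).
have := IH (fun i iN => Xy i (leqW iN)) (fun i iN => Xp i (leqW iN))
  (fun i iN => Xm i (leqW iN)).
rewrite !dotvDl !dotvNl -natr1; lra.
Qed.

(* The chain of [four_points] lives on a copy of the segment from [o] to
   [o + u] shrunk towards the centroid of the triangle, so that the points
   off the segment stay in [X]. *)
Lemma secant_scaled o u p b : X o -> X (o + u) -> X (o + p) -> 0 < b ->
  mu * enorm (b *: p + 2^-1 *: u) ^+ 2 - L * enorm (b *: p - 2^-1 *: u) ^+ 2
  <= 2 * b * dotv (g (o + u) - g o) p.
Proof.
move=> Xo Xu Xp b0; set Q := (X in X <= _).
(* [e / 3 * K] bounds the cost of moving the ends of the shrunk segment back to [o] and [o + u]; the
   extra [Q] pays for the factor [1 - e]. *)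
set K := L * enorm (p - 2 *: u) * enorm p + L * enorm (u + p) * enorm p.
apply: (@ler_lim0 R _ _ (Q + 2 * b * (3^-1 * K))) => e e0 e1.
have [n nE] : exists n, 3 * b / e < n.+1%:R.
  by exists (Num.truncn (3 * b / e)); exact: truncnS_gt.
have [N NE] : exists N : R, N = n.+1%:R by exists n.+1%:R.
have N0 : 0 < N by rewrite NE ltr0n.
have Ne : b / N <= e / 3.
  rewrite ler_pdivrMr // mulrAC ler_pdivlMr //.
  by move: nE; rewrite ltr_pdivrMr // -NE; lra.
pose c := (1 - e) / N; have c0 : 0 < c by rewrite divr_gt0 // subr_gt0.
have cb : c * b <= e / 3.
  apply: le_trans Ne; rewrite /c mulrAC ler_pM2r ?invr_gt0 //; nra.
have cb0 : 0 < c * b by rewrite mulr_gt0.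
have cN : c * N = 1 - e by rewrite /c divfK // gt_eqF.
(* The weights of [u] and [p] in the points below sum to at most
   [(1 - e) + e / 3 + 2 * (e / 3) = 1], leaving room for offsets up to [e / 3] along [p]. *)
pose y := o + (e / 3) *: u + (e / 3) *: p.
have tri s r : 0 <= s -> s <= N -> - (e / 3) <= r -> r <= e / 3 ->
    X (y + s *: (c *: u) + r *: p).
  move=> s0 sN r0 r1.
  have sc0 : 0 <= s * c by rewrite mulr_ge0 // ltW.
  have scN : s * c <= 1 - e by rewrite -cN mulrC ler_pM2l.
  have := convex_triangle o u p (s * c + e / 3) (e / 3 + r) Xo Xu Xp.
  have -> : o + (s * c + e / 3) *: u + (e / 3 + r) *: p
      = y + s *: (c *: u) + r *: p.
    by rewrite /y; apply/rowP => i; rewrite !mxE; ring.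
  by apply; lra.
have seg s : 0 <= s -> s <= N -> X (y + s *: (c *: u)).
  move=> s0 sN; have := tri s 0 s0 sN.
  by rewrite scale0r addr0; apply; lra.
have half (i : nat) : (i < n.+1)%N -> 0 <= (i%:R + 2^-1 : R) /\ (i%:R + 2^-1 : R) <= N.
  rewrite -(ler_nat R) -(natr1 i) -NE => iN; have := ler0n R i.
  by lra.
have := four_points_chain y (c *: u) ((c * b) *: p) n.+1.
have -> : (c * b) *: p - 2^-1 *: (c *: u) = c *: (b *: p - 2^-1 *: u).
  by apply/rowP => i; rewrite !mxE; ring.
have -> : (c * b) *: p + 2^-1 *: (c *: u) = c *: (b *: p + 2^-1 *: u).
  by apply/rowP => i; rewrite !mxE; ring.
rewrite !(enormZ c) ?(ltW c0) // dotvZr -NE => /(_ _)/wrap[].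
  by move=> i iN; apply: seg; rewrite ?ler0n // NE ler_nat.
move=> /(_ _)/wrap[].
  by move=> i /half[h1 h2]; apply: tri => //; lra.
move=> /(_ _)/wrap[].
  by move=> i /half[h1 h2]; rewrite -scaleNr; apply: tri => //; lra.
set D := dotv _ p => hD.
have hQ : (1 - e) * Q <= 2 * b * D.
  by rewrite -(ler_pM2l c0) -cN /Q; move: hD; lra.
have Xy0 : X y by rewrite -[y]addr0 -(scale0r (c *: u)); apply: seg; rewrite ?(ltW N0).
have := smooth_dotv _ _ p (seg N (ltW N0) (lexx _)) Xu.
have -> : y + N *: (c *: u) - (o + u) = (e / 3) *: (p - 2 *: u).
  rewrite scalerA (mulrC N) cN /y.
  by apply/rowP => i; rewrite !mxE; field.
have := smooth_dotv _ _ p Xo Xy0.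
have -> : o - y = - ((e / 3) *: (u + p)).
  by rewrite /y; apply/rowP => i; rewrite !mxE; ring.
rewrite enormN !enormZ ?divr_ge0 ?(ltW e0) //.
move=> h1 h2.
have : D - dotv (g (o + u) - g o) p <= e * (3^-1 * K).
  by move: h1 h2; rewrite /D /K !dotvDl !dotvNl; lra.
rewrite -(ler_pM2l (mulr_gt0 (ltr0Sn R 1) b0)); lra.
Qed.

Lemma secant_ineq o u p : X o -> X (o + u) -> X (o + p) ->
  (L + mu) * dotv p u - (L - mu) * (enorm u * enorm p)
  <= 2 * dotv (g (o + u) - g o) p.
Proof.
move=> Xo Xu Xp.
have := enorm_ge0 u; rewrite le_eqVlt => /predU1P[/esym u0|u0].
  rewrite u0 (enorm0_eq0 _ u0) addr0 subrr mul0r mulr0 subr0.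
  by rewrite -(scale0r p) !(dotvZl, dotvZr) !(mul0r, mulr0).
have := enorm_ge0 p; rewrite le_eqVlt => /predU1P[/esym p0|p0].
  rewrite p0 (enorm0_eq0 _ p0) !mulr0 subr0.
  by rewrite -(scale0r u) !(dotvZl, dotvZr) !(mul0r, mulr0).
(* After division by [b], the term [b |p|^2 + |u|^2 / (4 b)] is least at this [b], with value
   [|u| |p|]. *)
have [b b0 uE] : exists2 b : R, 0 < b & enorm u = 2 * b * enorm p.
  exists (enorm u / (2 * enorm p)); first by rewrite divr_gt0 // mulr_gt0.
  by field; rewrite gt_eqF.
have := secant_scaled o u p b Xo Xu Xp b0.
rewrite !enorm_sqr !dotvE (dotvC u p) -!enorm_sqr uE => h.
rewrite -(ler_pM2l b0); move: h; lra.
Qed.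

(** * One step of the iteration, in coordinates centred at [xs] *)

Lemma local_LMO_step xs u p t : X (xs + u) -> is_argmin X f xs ->
  is_argmin (X `&` eball (xs + u) t) (dotv (g (xs + u))) (xs + p) ->
  t = theta L mu * enorm u ->
  enorm p <= (L - mu) / (L + mu) * enorm u.
Proof.
move=> Xx ms [[Xxp]]; rewrite /eball /= => xpt mxp tE.
have [Xs _] := ms.
set k := (L - mu) / (L + mu).
have Lmu0 : 0 < L + mu by rewrite addr_gt0 // (lt_le_trans mu0).
have k0 : 0 <= k by rewrite divr_ge0 // ?subr_ge0 // ltW.
have kE : k * (L + mu) = L - mu by rewrite /k divfK // gt_eqF.
have t2 : t ^+ 2 = (1 - k ^+ 2) * enorm u ^+ 2.
  by rewrite tE exprMn theta_sqr.
have t0 : 0 <= t by exact: le_trans (enorm_ge0 _) xpt.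
rewrite leNgt; apply/negP => ltp.
have U0 := enorm_ge0 u.
have P0 : 0 < enorm p by apply: le_lt_trans ltp; rewrite mulr_ge0.
have vE : xs + p - (xs + u) = p - u by rewrite opprD addrACA subrr add0r.
move: xpt; rewrite vE enorm_le // t2 !dotvE (dotvC u p) -!enorm_sqr => hv.
have gp : 0 < dotv (g (xs + u)) p.
  have := argmin_dotv_ge0 _ _ ms Xxp; rewrite [xs + p]addrC addrK => gs.
  have := secant_ineq xs u p Xs Xx Xxp.
  rewrite dotvDl dotvNl -kE.
  have : 0 < (L + mu) * (dotv p u - k * (enorm u * enorm p)).
    rewrite mulr_gt0 //.
    (* The ball constraint reads [2 <p, u> >= |p|^2 + k^2 |u|^2], so this square is at most
       [2 (<p, u> - k |u| |p|)]. *)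
    have : 0 < (enorm p - k * enorm u) ^+ 2 by rewrite exprn_gt0 // subr_gt0.
    by nra.
  lra.
pose s := 1 - (k * enorm u) ^+ 2 / enorm p ^+ 2.
have P20 : 0 < enorm p ^+ 2 by rewrite exprn_gt0.
have sE : (1 - s) * enorm p ^+ 2 = (k * enorm u) ^+ 2.
  by rewrite /s subKr divfK // gt_eqF.
have s1 : s <= 1 by rewrite gerBl divr_ge0 // sqr_ge0.
have s0 : 0 < s.
  by rewrite subr_gt0 ltr_pdivrMr // mul1r ltr_sqr ?nnegrE ?(mulr_ge0 k0) ?enorm_ge0.
have Xz := convex_segment _ _ _ Xxp Xs (ltW s0) s1.
have /mxp : (X `&` eball (xs + u) t) (xs + p + s *: (xs - (xs + p))).
  split => //; rewrite /eball /= enorm_le // t2.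
  have -> : xs + p + s *: (xs - (xs + p)) - (xs + u) = (1 - s) *: p - u.
    by apply/rowP => i; rewrite !mxE; ring.
  rewrite !dotvE (dotvC u p) -!enorm_sqr sE.
  (* By the ball constraint and [sE], the squared distance is at most [(1 - k^2) |u|^2], exactly the
     squared radius. *)
  have : (1 - s) * (enorm p ^+ 2 + (k * enorm u) ^+ 2) <=
      (1 - s) * (2 * dotv p u) by rewrite ler_wpM2l ?subr_ge0 //; lra.
  rewrite mulrDr sE; lra.
rewrite [leRHS]dotvDr dotvZr opprD addNKr dotvNr.
have : 0 < s * dotv (g (xs + u)) p by rewrite mulr_gt0.
lra.
Qed.

End SmoothStronglyConvex.

(** * One-step contraction and its iteration *)

Theorem theorem3 (R : realType) (d : nat) (X : set 'rV[R]_d)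
  (f : 'rV[R]_d -> R) (g : 'rV[R]_d -> 'rV[R]_d) (L mu : R)
  (t : nat -> R) (x : nat -> 'rV[R]_d) (xs : 'rV[R]_d) :
  X !=set0 -> closed X -> convex_set X ->
  is_gradient f g -> 0 < mu -> mu <= L ->
  smooth_on X g L -> strongly_convex_on X f g mu ->
  (exists z, is_argmin X f z) ->
  local_LMO X g t x ->
  is_argmin X f xs ->
  (forall k : nat, g (x k) != g xs ->
     t k = theta L mu * enorm (x k - xs) ->
     enorm (x k.+1 - xs) ^+ 2 <= (1 - theta L mu ^+ 2) * enorm (x k - xs) ^+ 2 /\
     (1 - theta L mu ^+ 2) * enorm (x k - xs) ^+ 2
       = ((L - mu) / (L + mu)) ^+ 2 * enorm (x k - xs) ^+ 2) /\
  ((forall k : nat, t k = theta L mu * enorm (x k - xs)) ->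
   forall K : nat,
     enorm (x K - xs) ^+ 2 <= ((L - mu) / (L + mu)) ^+ (2 * K) * enorm (x 0%N - xs) ^+ 2).
Proof.
move=> _ _ cX _ mu0 muL smo sc _ [X0 step] ms.
have Xx k : X (x k) by case: k => // k; have [[]] := step k.
have contr k : t k = theta L mu * enorm (x k - xs) ->
    enorm (x k.+1 - xs) ^+ 2 <= ((L - mu) / (L + mu)) ^+ 2 * enorm (x k - xs) ^+ 2.
  move=> tk; rewrite -exprMn ler_sqr ?nnegrE ?enorm_ge0 //.
    apply: (local_LMO_step X f g L mu cX mu0 muL smo sc xs _ _ (t k)) => //.
      by rewrite addrC subrK.
    by rewrite ![xs + _]addrC !subrK.
  by rewrite mulr_ge0 ?enorm_ge0 // divr_ge0; lra.
split=> [k _ tk|tE].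
  by rewrite theta_sqr // subKr; split => //; exact: contr.
elim=> [|K IH]; first by rewrite muln0 mul1r.
apply: le_trans (contr K (tE K)) _.
by rewrite mulnS exprD -mulrA ler_wpM2l ?sqr_ge0.
Qed.
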